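(* Let $n,p\in\mathbb{N}$ with $n\neq p$. Then the two natural transformations ${}_{n}\mathsf{d}_M\colon FM\to FM\otimes M$ and ${}_{p}\mathsf{d}_M\colon FM\to FM\otimes M$ ($M$ ranging over commutative monoids) are distinct, that is, there is a commutative monoid $M$ with ${}_{n}\mathsf{d}_M\neq{}_{p}\mathsf{d}_M$.
   Context: $\otimes$ is the tensor product of commutative monoids (universal for maps that are additive and zero-preserving in each variable), with symmetry $\sigma$; associators are treated as identities. For a commutative monoid $(M,+,0)$, let $F_0M$ be the set of formal expressions freely generated inductively by: $0$; $1$; $x_m$ for each $m\in M$; $(a+b)$ and $(ab)$ for $a,b\in F_0M$; $f(a)$ for $a\in F_0M$. Let $\sim$ be the smallest equivalence relation on $F_0M$ such that for all $a,b,c\in F_0M$ and $m,m'\in M$: $((a+b)+c)\sim(a+(b+c))$; $(a+0)\sim a$; $(a+b)\sim(b+a)$; $((ab)c)\sim(a(bc))$; $(a1)\sim a$; $(ab)\sim(ba)$; $((a+b)c)\sim((ac)+(bc))$; $(0a)\sim 0$; $x_0\sim 0$; $(x_m+x_{m'})\sim x_{m+m'}$; and $a\sim b$ implies $(a+c)\sim(b+c)$, $(ac)\sim(bc)$, $f(a)\sim f(b)$. Set $FM:=F_0M/\sim$, with $[a]$ the class of $a$; it is a commutative rig (commutative semiring with $0$ and $1$) with $[a]+[b]=[(a+b)]$, $[a][b]=[(ab)]$, zero $[0]$, unit $[1]$, viewed as a commutative monoid under $+$. $\nabla_M\colon FM\otimes FM\to FM$ is the unique monoid homomorphism with $\nabla_M([a]\otimes[b])=[a][b]$.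 For $n\in\mathbb{N}$, define ${}_{n}\mathsf{d}^0_M\colon F_0M\to FM\otimes M$ by induction: ${}_{n}\mathsf{d}^0_M(0)=0$; ${}_{n}\mathsf{d}^0_M(1)=0$; ${}_{n}\mathsf{d}^0_M(x_m)=[1]\otimes m$; ${}_{n}\mathsf{d}^0_M((ab))=(\nabla_M\otimes\mathrm{id}_M)([a]\otimes{}_{n}\mathsf{d}^0_M(b))+\big((\nabla_M\otimes\mathrm{id}_M)\circ(\mathrm{id}_{FM}\otimes\sigma_{M,FM})\big)({}_{n}\mathsf{d}^0_M(a)\otimes[b])$; ${}_{n}\mathsf{d}^0_M((a+b))={}_{n}\mathsf{d}^0_M(a)+{}_{n}\mathsf{d}^0_M(b)$; ${}_{n}\mathsf{d}^0_M(f(a))=n\cdot{}_{n}\mathsf{d}^0_M(a)$. This is invariant under $\sim$, and ${}_{n}\mathsf{d}_M([a]):={}_{n}\mathsf{d}^0_M(a)$ defines a monoid homomorphism natural in $M$. *)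

(* Defs.v *)
From HB Require Import structures.
From mathcomp Require Import all_boot all_order all_algebra.
From mathcomp Require Import boolp.

Set Implicit Arguments.
Unset Strict Implicit.
Unset Printing Implicit Defensive.

Import GRing.Theory.
Local Open Scope ring_scope.
Local Open Scope quotient_scope.

(* Commutative monoids are MathComp's [nmodType]s, monoid homomorphisms are
   [{additive A -> B}], and commutative rigs (possibly trivial) are
   [comPzSemiRingType]s.  The eqType and choiceType structures carried by a
   [nmodType] hold no mathematical content: classical choice supplies them. *)

Section Tensor.
Variables A B : nmodType.

Inductive tensor_expr : Type :=
| TZero
| TPure of A & B
| TAdd of tensor_expr & tensor_expr.

Inductive tensor_eqv : tensor_expr -> tensor_expr -> Prop :=
| teq_refl t : tensor_eqv t t
| teq_sym s t : tensor_eqv s t -> tensor_eqv t s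
| teq_trans s t u : tensor_eqv s t -> tensor_eqv t u -> tensor_eqv s u
| teq_addl s t u : tensor_eqv s t -> tensor_eqv (TAdd s u) (TAdd t u)
| teq_addA s t u : tensor_eqv (TAdd s (TAdd t u)) (TAdd (TAdd s t) u)
| teq_addC s t : tensor_eqv (TAdd s t) (TAdd t s)
| teq_add0 t : tensor_eqv (TAdd TZero t) t
| teq_pure0l b : tensor_eqv (TPure 0 b) TZero
| teq_pure0r a : tensor_eqv (TPure a 0) TZero
| teq_pureDl a a' b :
    tensor_eqv (TPure (a + a') b) (TAdd (TPure a b) (TPure a' b))
| teq_pureDr a b b' :
    tensor_eqv (TPure a (b + b')) (TAdd (TPure a b) (TPure a b')).

HB.instance Definition _ := gen_eqMixin tensor_expr.
HB.instance Definition _ := gen_choiceMixin tensor_expr.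

Definition tensor_rel : rel tensor_expr := fun s t => `[< tensor_eqv s t >].

Lemma tensor_rel_refl : reflexive tensor_rel.
Proof. by move=> t; apply/asboolP; apply: teq_refl. Qed.

Lemma tensor_rel_sym : symmetric tensor_rel.
Proof. by move=> s t; apply/asboolP/asboolP; apply: teq_sym. Qed.

Lemma tensor_rel_trans : transitive tensor_rel.
Proof.
by move=> t s u /asboolP st /asboolP tu; apply/asboolP; apply: teq_trans st tu.
Qed.

Definition tensor_equiv :=
  EquivRel tensor_rel tensor_rel_refl tensor_rel_sym tensor_rel_trans.

Definition tensor := {eq_quot tensor_equiv}.

HB.instance Definition _ := Choice.on tensor.
HB.instance Definition _ := Quotient.on tensor.

Definition tensor_class (t : tensor_expr) : tensor := \pi_tensor t.

Lemma tensor_classP s t : tensor_class s = tensor_class t <-> tensor_eqv s t.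
Proof.
split=> [/eqP|st]; first by rewrite eqmodE => /asboolP.
by apply/eqP; rewrite eqmodE; apply/asboolP.
Qed.

Lemma tensor_class_ind (P : tensor -> Prop) :
  (forall t, P (tensor_class t)) -> forall u, P u.
Proof. by move=> Pcl u; rewrite -[u]reprK; apply: Pcl. Qed.

Lemma teq_repr t : tensor_eqv (repr (tensor_class t)) t.
Proof. by apply/tensor_classP; rewrite /tensor_class reprK. Qed.

Definition tensor_add (u v : tensor) : tensor :=
  tensor_class (TAdd (repr u) (repr v)).

Lemma teq_add s s' t t' :
  tensor_eqv s s' -> tensor_eqv t t' -> tensor_eqv (TAdd s t) (TAdd s' t').
Proof.
move=> ss tt; apply: (teq_trans (teq_addl _ ss)).
apply: (teq_trans (teq_addC _ _)).
by apply: (teq_trans (teq_addl _ tt)); apply: teq_addC.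
Qed.

Lemma tensor_addE s t :
  tensor_add (tensor_class s) (tensor_class t) = tensor_class (TAdd s t).
Proof. by apply/tensor_classP; apply: teq_add; apply: teq_repr. Qed.

Fact tensor_addA : associative tensor_add.
Proof.
elim/tensor_class_ind=> s; elim/tensor_class_ind=> t; elim/tensor_class_ind=> u.
by rewrite !tensor_addE; apply/tensor_classP; apply: teq_addA.
Qed.

Fact tensor_addC : commutative tensor_add.
Proof.
elim/tensor_class_ind=> s; elim/tensor_class_ind=> t.
by rewrite !tensor_addE; apply/tensor_classP; apply: teq_addC.
Qed.

Fact tensor_add0 : left_id (tensor_class TZero) tensor_add.
Proof.
elim/tensor_class_ind=> s.
by rewrite !tensor_addE; apply/tensor_classP; apply: teq_add0.
Qed.

HB.instance Definition _ :=
  GRing.isNmodule.Build tensor tensor_addA tensor_addC tensor_add0.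

Definition pure (a : A) (b : B) : tensor := tensor_class (TPure a b).

Lemma tensor_classD s t :
  tensor_class (TAdd s t) = tensor_class s + tensor_class t.
Proof. by rewrite -tensor_addE. Qed.

Lemma tensor_class0 : tensor_class TZero = 0.
Proof. by []. Qed.

Lemma pure0l b : pure 0 b = 0.
Proof. by apply/tensor_classP; apply: teq_pure0l. Qed.

Lemma pure0r a : pure a 0 = 0.
Proof. by apply/tensor_classP; apply: teq_pure0r. Qed.

Lemma pureDl a a' b : pure (a + a') b = pure a b + pure a' b.
Proof. by rewrite -tensor_classD; apply/tensor_classP; apply: teq_pureDl. Qed.

Lemma pureDr a b b' : pure a (b + b') = pure a b + pure a b'.
Proof. by rewrite -tensor_classD; apply/tensor_classP; apply: teq_pureDr. Qed.

Lemma tensor_ind (P : tensor -> Prop) :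
  P 0 -> (forall a b, P (pure a b)) -> (forall u v, P u -> P v -> P (u + v)) ->
  forall u, P u.
Proof.
move=> P0 Pp PD; apply: tensor_class_ind; elim=> [||s Ps t Pt] //=.
by rewrite tensor_classD; apply: PD.
Qed.

Lemma eq_tensor (C : nmodType) (f g : {additive tensor -> C}) :
  (forall a b, f (pure a b) = g (pure a b)) -> f =1 g.
Proof.
move=> fg; apply: tensor_ind => [|//|u v fgu fgv]; first by rewrite !raddf0.
by rewrite !raddfD fgu fgv.
Qed.

End Tensor.

Notation "A ⊗ B" := (tensor A B) (at level 40, left associativity) : type_scope.
Notation "a ⊗ b" := (pure a b) (at level 40, left associativity) : ring_scope.

Definition bimorphism (A B C : nmodType) (g : A -> B -> C) : Prop :=
  [/\ forall b, g 0 b = 0, forall a, g a 0 = 0,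
      forall a a' b, g (a + a') b = g a b + g a' b
    & forall a b b', g a (b + b') = g a b + g a b'].

Section Lift.
Variables (A B C : nmodType) (g : A -> B -> C).
Hypothesis g_bim : bimorphism g.

Fixpoint tensor_lift_expr (t : tensor_expr A B) : C :=
  match t with
  | TZero => 0
  | TPure a b => g a b
  | TAdd s t => tensor_lift_expr s + tensor_lift_expr t
  end.

Lemma tensor_lift_eqv s t :
  tensor_eqv s t -> tensor_lift_expr s = tensor_lift_expr t.
Proof.
case: g_bim => g0l g0r gDl gDr; elim=> {s t} //=.
- by move=> s t u _ -> _ ->.
- by move=> s t u _ ->.
- by move=> s t u; rewrite addrA.
- by move=> s t; rewrite addrC.
- by move=> t; rewrite add0r.
Qed.

(* The hypothesis [g_bim] is an explicit argument so that [tensor_lift] is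
   canonically additive. *)
Definition tensor_lift of bimorphism g : A ⊗ B -> C :=
  fun u => tensor_lift_expr (repr u).

Lemma tensor_lift_class t :
  tensor_lift g_bim (tensor_class t) = tensor_lift_expr t.
Proof. by apply: tensor_lift_eqv; apply: teq_repr. Qed.

End Lift.

Section LiftTheory.
Variables (A B C : nmodType) (g : A -> B -> C) (g_bim : bimorphism g).

Fact tensor_lift_additive : nmod_morphism (tensor_lift g_bim).
Proof.
split; first by rewrite -tensor_class0 (tensor_lift_class g_bim).
elim/tensor_class_ind=> s; elim/tensor_class_ind=> t.
by rewrite -tensor_classD !(tensor_lift_class g_bim).
Qed.

HB.instance Definition _ :=
  GRing.isNmodMorphism.Build (A ⊗ B)%type C (tensor_lift g_bim)
    tensor_lift_additive.

Lemma tensor_lift_pure a b : tensor_lift g_bim (a ⊗ b) = g a b.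
Proof. by rewrite (tensor_lift_class g_bim). Qed.

Lemma tensor_lift_unique (h : {additive A ⊗ B -> C}) :
  (forall a b, h (a ⊗ b) = g a b) -> h =1 tensor_lift g_bim.
Proof. by move=> hg; apply: eq_tensor => a b; rewrite hg /= tensor_lift_pure. Qed.

End LiftTheory.

Section TensorMap.
Variables (A A' B B' : nmodType).
Variables (f : {additive A -> A'}) (g : {additive B -> B'}).

Fact tensor_map_bim : bimorphism (fun a b => f a ⊗ g b).
Proof.
split=> [b|a|a a' b|a b b']; rewrite ?raddf0 ?raddfD.
- exact: pure0l.
- exact: pure0r.
- exact: pureDl.
- exact: pureDr.
Qed.

Definition tensor_map : {additive A ⊗ B -> A' ⊗ B'} :=
  tensor_lift tensor_map_bim.

Lemma tensor_map_pure a b : tensor_map (a ⊗ b) = f a ⊗ g b.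
Proof. exact: tensor_lift_pure. Qed.

End TensorMap.

Section TensorSym.
Variables A B : nmodType.

Fact tensor_sym_bim : bimorphism (fun (a : A) (b : B) => b ⊗ a).
Proof.
split=> *; [exact: pure0r | exact: pure0l | exact: pureDr | exact: pureDl].
Qed.

Definition tensor_sym : {additive A ⊗ B -> B ⊗ A} :=
  tensor_lift tensor_sym_bim.

Lemma tensor_sym_pure a b : tensor_sym (a ⊗ b) = b ⊗ a.
Proof. exact: tensor_lift_pure. Qed.

End TensorSym.

Arguments tensor_sym : clear implicits.

Section TensorAssoc.
Variables A B C : nmodType.

Fact tensor_assoc_aux_bim (c : C) :
  bimorphism (fun (a : A) (b : B) => a ⊗ (b ⊗ c)).
Proof.
split=> *; first exact: pure0l.
- by rewrite pure0l pure0r.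
- exact: pureDl.
- by rewrite pureDl pureDr.
Qed.

Fact tensor_assoc_bim :
  bimorphism (fun u (c : C) => tensor_lift (tensor_assoc_aux_bim c) u).
Proof.
split=> [c|u|u v c|u c c']; rewrite ?raddf0 ?raddfD //.
- elim/tensor_ind: u => [|a b|u v u0 v0]; first exact: raddf0.
    by rewrite tensor_lift_pure !pure0r.
  by rewrite raddfD /= u0 v0 addr0.
- elim/tensor_ind: u => [|a b|u v uE vE]; first by rewrite !raddf0 addr0.
    by rewrite !tensor_lift_pure !pureDr.
  by rewrite !raddfD /= uE vE addrACA.
Qed.

Definition tensor_assoc : {additive (A ⊗ B) ⊗ C -> A ⊗ (B ⊗ C)} :=
  tensor_lift tensor_assoc_bim.

Lemma tensor_assoc_pure a b c : tensor_assoc ((a ⊗ b) ⊗ c) = a ⊗ (b ⊗ c).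
Proof. by rewrite /= !tensor_lift_pure. Qed.

Fact tensor_assocV_aux_bim (a : A) :
  bimorphism (fun (b : B) (c : C) => (a ⊗ b) ⊗ c).
Proof.
split=> *; last exact: pureDr.
- by rewrite pure0r pure0l.
- exact: pure0r.
- by rewrite pureDr pureDl.
Qed.

Fact tensor_assocV_bim :
  bimorphism (fun (a : A) u => tensor_lift (tensor_assocV_aux_bim a) u).
Proof.
split=> [u|a|a a' u|a u v]; rewrite ?raddf0 ?raddfD //.
- elim/tensor_ind: u => [|b c|u v u0 v0]; first exact: raddf0.
    by rewrite tensor_lift_pure !pure0l.
  by rewrite raddfD /= u0 v0 addr0.
- elim/tensor_ind: u => [|b c|u v uE vE]; first by rewrite !raddf0 addr0.
    by rewrite !tensor_lift_pure !pureDl.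
  by rewrite !raddfD /= uE vE addrACA.
Qed.

Definition tensor_assocV : {additive A ⊗ (B ⊗ C) -> (A ⊗ B) ⊗ C} :=
  tensor_lift tensor_assocV_bim.

Lemma tensor_assocV_pure a b c : tensor_assocV (a ⊗ (b ⊗ c)) = (a ⊗ b) ⊗ c.
Proof. by rewrite /= !tensor_lift_pure. Qed.

End TensorAssoc.

Arguments tensor_assoc : clear implicits.
Arguments tensor_assocV : clear implicits.

Section FreeRig.
Variable M : nmodType.

Inductive F0 : Type :=
| FZero
| FOne
| FVar of M
| FAdd of F0 & F0
| FMul of F0 & F0
| Ffun of F0.

Inductive F_eqv : F0 -> F0 -> Prop :=
| feq_refl a : F_eqv a a
| feq_sym a b : F_eqv a b -> F_eqv b a
| feq_trans a b c : F_eqv a b -> F_eqv b c -> F_eqv a c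
| feq_addA a b c : F_eqv (FAdd (FAdd a b) c) (FAdd a (FAdd b c))
| feq_add0 a : F_eqv (FAdd a FZero) a
| feq_addC a b : F_eqv (FAdd a b) (FAdd b a)
| feq_mulA a b c : F_eqv (FMul (FMul a b) c) (FMul a (FMul b c))
| feq_mul1 a : F_eqv (FMul a FOne) a
| feq_mulC a b : F_eqv (FMul a b) (FMul b a)
| feq_mulD a b c : F_eqv (FMul (FAdd a b) c) (FAdd (FMul a c) (FMul b c))
| feq_mul0 a : F_eqv (FMul FZero a) FZero
| feq_var0 : F_eqv (FVar 0) FZero
| feq_varD m m' : F_eqv (FAdd (FVar m) (FVar m')) (FVar (m + m'))
| feq_addl a b c : F_eqv a b -> F_eqv (FAdd a c) (FAdd b c)
| feq_mull a b c : F_eqv a b -> F_eqv (FMul a c) (FMul b c)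
| feq_fun a b : F_eqv a b -> F_eqv (Ffun a) (Ffun b).

HB.instance Definition _ := gen_eqMixin F0.
HB.instance Definition _ := gen_choiceMixin F0.

Definition F_rel : rel F0 := fun a b => `[< F_eqv a b >].

Lemma F_rel_refl : reflexive F_rel.
Proof. by move=> a; apply/asboolP; apply: feq_refl. Qed.

Lemma F_rel_sym : symmetric F_rel.
Proof. by move=> a b; apply/asboolP/asboolP; apply: feq_sym. Qed.

Lemma F_rel_trans : transitive F_rel.
Proof.
by move=> b a c /asboolP ab /asboolP bc; apply/asboolP; apply: feq_trans ab bc.
Qed.

Definition F_equiv := EquivRel F_rel F_rel_refl F_rel_sym F_rel_trans.

Definition F := {eq_quot F_equiv}.

HB.instance Definition _ := Choice.on F.
HB.instance Definition _ := Quotient.on F.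

Definition F_class (a : F0) : F := \pi_F a.

Lemma F_classP a b : F_class a = F_class b <-> F_eqv a b.
Proof.
split=> [/eqP|ab]; first by rewrite eqmodE => /asboolP.
by apply/eqP; rewrite eqmodE; apply/asboolP.
Qed.

Lemma F_class_ind (P : F -> Prop) :
  (forall a, P (F_class a)) -> forall u, P u.
Proof. by move=> Pcl u; rewrite -[u]reprK; apply: Pcl. Qed.

Lemma feq_repr a : F_eqv (repr (F_class a)) a.
Proof. by apply/F_classP; rewrite /F_class reprK. Qed.

Definition F_add (u v : F) : F := F_class (FAdd (repr u) (repr v)).
Definition F_mul (u v : F) : F := F_class (FMul (repr u) (repr v)).

Lemma F_addE a b : F_add (F_class a) (F_class b) = F_class (FAdd a b).
Proof.
apply/F_classP; apply: (feq_trans (feq_addl _ (feq_repr a))).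
apply: (feq_trans (feq_addC _ _)).
by apply: (feq_trans (feq_addl _ (feq_repr b))); apply: feq_addC.
Qed.

Lemma F_mulE a b : F_mul (F_class a) (F_class b) = F_class (FMul a b).
Proof.
apply/F_classP; apply: (feq_trans (feq_mull _ (feq_repr a))).
apply: (feq_trans (feq_mulC _ _)).
by apply: (feq_trans (feq_mull _ (feq_repr b))); apply: feq_mulC.
Qed.

Fact F_addA : associative F_add.
Proof.
elim/F_class_ind=> a; elim/F_class_ind=> b; elim/F_class_ind=> c.
by rewrite !F_addE; apply/F_classP; apply/feq_sym/feq_addA.
Qed.

Fact F_addC : commutative F_add.
Proof.
elim/F_class_ind=> a; elim/F_class_ind=> b.
by rewrite !F_addE; apply/F_classP; apply: feq_addC.
Qed.

Fact F_add0 : left_id (F_class FZero) F_add.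
Proof.
elim/F_class_ind=> a; rewrite F_addC F_addE.
by apply/F_classP; apply: feq_add0.
Qed.

HB.instance Definition _ := GRing.isNmodule.Build F F_addA F_addC F_add0.

Lemma F_classD a b : F_class (FAdd a b) = F_class a + F_class b.
Proof. by rewrite -F_addE. Qed.

Fact F_mulA : associative F_mul.
Proof.
elim/F_class_ind=> a; elim/F_class_ind=> b; elim/F_class_ind=> c.
by rewrite !F_mulE; apply/F_classP; apply/feq_sym/feq_mulA.
Qed.

Fact F_mulC : commutative F_mul.
Proof.
elim/F_class_ind=> a; elim/F_class_ind=> b.
by rewrite !F_mulE; apply/F_classP; apply: feq_mulC.
Qed.

Fact F_mul1 : left_id (F_class FOne) F_mul.
Proof.
elim/F_class_ind=> a; rewrite F_mulC F_mulE.
by apply/F_classP; apply: feq_mul1.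
Qed.

Fact F_mulDl : left_distributive F_mul +%R.
Proof.
elim/F_class_ind=> a; elim/F_class_ind=> b; elim/F_class_ind=> c.
by rewrite -F_classD !F_mulE -F_classD; apply/F_classP; apply: feq_mulD.
Qed.

Fact F_mul0 : left_zero 0 F_mul.
Proof.
elim/F_class_ind=> a; rewrite -[0]/(F_class FZero) F_mulE.
by apply/F_classP; apply: feq_mul0.
Qed.

HB.instance Definition _ := GRing.Nmodule_isComPzSemiRing.Build F
  F_mulA F_mulC F_mul1 F_mulDl F_mul0.

Lemma F_class0 : F_class FZero = 0.
Proof. by []. Qed.

Lemma F_class1 : F_class FOne = 1.
Proof. by []. Qed.

Lemma F_classM a b : F_class (FMul a b) = F_class a * F_class b.
Proof. by rewrite -F_mulE. Qed.

Fact F_nabla_bim : bimorphism (fun u v : F => u * v).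
Proof.
split=> *; [exact: mul0r | exact: mulr0 | exact: mulrDl | exact: mulrDr].
Qed.

Definition F_nabla : {additive F ⊗ F -> F} := tensor_lift F_nabla_bim.

Lemma F_nabla_pure u v : F_nabla (u ⊗ v) = u * v.
Proof. exact: tensor_lift_pure. Qed.

Definition nabla_id : {additive (F ⊗ F) ⊗ M -> F ⊗ M} :=
  tensor_map F_nabla idfun.

Definition id_sym : {additive F ⊗ (M ⊗ F) -> F ⊗ (F ⊗ M)} :=
  tensor_map idfun (tensor_sym M F).

(* [tensor_assoc] and [tensor_assocV] make explicit the associators
   (F ⊗ M) ⊗ F -> F ⊗ (M ⊗ F) and F ⊗ (F ⊗ M) -> (F ⊗ F) ⊗ M. *)
Fixpoint nd0 (n : nat) (a : F0) : F ⊗ M :=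
  match a with
  | FZero => 0
  | FOne => 0
  | FVar m => 1 ⊗ m
  | FAdd a b => nd0 n a + nd0 n b
  | FMul a b =>
      nabla_id (tensor_assocV F F M (F_class a ⊗ nd0 n b)) +
      nabla_id (tensor_assocV F F M
        (id_sym (tensor_assoc F M F (nd0 n a ⊗ F_class b))))
  | Ffun a => nd0 n a *+ n
  end.

Definition lact (u : F) (t : F ⊗ M) : F ⊗ M :=
  nabla_id (tensor_assocV F F M (u ⊗ t)).

Lemma lact0l t : lact 0 t = 0.
Proof. by rewrite /lact pure0l !raddf0. Qed.

Lemma lact0r u : lact u 0 = 0.
Proof. by rewrite /lact pure0r !raddf0. Qed.

Lemma lactDl u v t : lact (u + v) t = lact u t + lact v t.
Proof. by rewrite /lact pureDl !raddfD. Qed.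

Lemma lactDr u s t : lact u (s + t) = lact u s + lact u t.
Proof. by rewrite /lact pureDr !raddfD. Qed.

Lemma lact_pure u v m : lact u (v ⊗ m) = (u * v) ⊗ m.
Proof. by rewrite /lact tensor_assocV_pure tensor_map_pure F_nabla_pure. Qed.

Lemma lact1 t : lact 1 t = t.
Proof.
elim/tensor_ind: t => [|u m|s t sE tE]; first exact: lact0r.
  by rewrite lact_pure mul1r.
by rewrite lactDr sE tE.
Qed.

Lemma lactM u v t : lact (u * v) t = lact u (lact v t).
Proof.
elim/tensor_ind: t => [|w m|s t sE tE]; first by rewrite !lact0r.
  by rewrite !lact_pure mulrA.
by rewrite !lactDr sE tE.
Qed.

Lemma ractE t u :
  nabla_id (tensor_assocV F F M (id_sym (tensor_assoc F M F (t ⊗ u)))) =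
  lact u t.
Proof.
elim/tensor_ind: t => [|v m|s t sE tE].
- by rewrite pure0l !raddf0 lact0r.
- rewrite tensor_assoc_pure tensor_map_pure tensor_sym_pure.
  by rewrite -/(lact _ _) !lact_pure mulrC.
- by rewrite pureDl !raddfD sE tE lactDr.
Qed.

Lemma nd0M n a b :
  nd0 n (FMul a b) = lact (F_class a) (nd0 n b) + lact (F_class b) (nd0 n a).
Proof. by rewrite /= ractE. Qed.

Lemma nd0_eqv n a b : F_eqv a b -> nd0 n a = nd0 n b.
Proof.
elim=> {a b}.
- by [].
- by move=> a b _ ->.
- by move=> a b c _ -> _ ->.
- by move=> a b c /=; rewrite addrA.
- by move=> a /=; rewrite addr0.
- by move=> a b /=; rewrite addrC.
- move=> a b c; rewrite !nd0M !F_classM !lactDr -!lactM addrA.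
  by rewrite [F_class c * _]mulrC [F_class c * _]mulrC.
- by move=> a; rewrite nd0M /= F_class1 lact1 lact0r add0r.
- by move=> a b; rewrite !nd0M addrC.
- move=> a b c; rewrite nd0M F_classD /= !ractE -!/(lact _ _).
  by rewrite lactDl lactDr addrACA.
- by move=> a; rewrite nd0M /= lact0l lact0r addr0.
- exact: pure0r.
- by move=> m m' /=; rewrite pureDr.
- by move=> a b c _ /= ->.
- by move=> a b c /F_classP ab IH; rewrite !nd0M ab IH.
- by move=> a b _ /= ->.
Qed.

Definition nd (n : nat) (u : F) : F ⊗ M := nd0 n (repr u).

Lemma ndE n a : nd n (F_class a) = nd0 n a.
Proof. by apply: nd0_eqv; apply: feq_repr. Qed.

Fact nd_additive n : nmod_morphism (nd n).
Proof.
split; first by rewrite -F_class0 ndE.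
elim/F_class_ind=> a; elim/F_class_ind=> b.
by rewrite -F_classD !ndE.
Qed.

HB.instance Definition _ n :=
  GRing.isNmodMorphism.Build F (F ⊗ M)%type (nd n) (nd_additive n).

End FreeRig.

Arguments FZero {M}.
Arguments FOne {M}.
Arguments nd M n u : clear implicits.

Section Naturality.
Variables (M M' : nmodType) (h : {additive M -> M'}).

Fixpoint F0_map (a : F0 M) : F0 M' :=
  match a with
  | FZero => FZero
  | FOne => FOne
  | FVar m => FVar (h m)
  | FAdd a b => FAdd (F0_map a) (F0_map b)
  | FMul a b => FMul (F0_map a) (F0_map b)
  | Ffun a => Ffun (F0_map a)
  end.

Lemma F0_map_eqv a b : F_eqv a b -> F_eqv (F0_map a) (F0_map b).
Proof.
elim=> {a b} /=; try by move=> *; constructor.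
- by move=> a b c _ ab _; apply: feq_trans.
- by rewrite raddf0; apply: feq_var0.
- by move=> m m'; rewrite raddfD; apply: feq_varD.
Qed.

Definition F_map (u : F M) : F M' := F_class (F0_map (repr u)).

Lemma F_mapE a : F_map (F_class a) = F_class (F0_map a).
Proof. by apply/F_classP; apply: F0_map_eqv; apply: feq_repr. Qed.

Fact F_map_additive : nmod_morphism F_map.
Proof.
split; first by rewrite -F_class0 F_mapE.
elim/F_class_ind=> a; elim/F_class_ind=> b.
by rewrite -F_classD !F_mapE -F_classD.
Qed.

HB.instance Definition _ :=
  GRing.isNmodMorphism.Build (F M) (F M') F_map F_map_additive.

Lemma F_mapM u v : F_map (u * v) = F_map u * F_map v.
Proof.
elim/F_class_ind: u => a; elim/F_class_ind: v => b.
by rewrite -F_classM !F_mapE -F_classM.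
Qed.

Lemma lact_map u t :
  tensor_map F_map h (lact u t) = lact (F_map u) (tensor_map F_map h t).
Proof.
elim/tensor_ind: t => [|v m|s t sE tE].
- by rewrite lact0r !raddf0 lact0r.
- by rewrite lact_pure !tensor_map_pure lact_pure /= F_mapM.
- by rewrite lactDr !raddfD sE tE lactDr.
Qed.

Lemma nd_natural n u : nd M' n (F_map u) = tensor_map F_map h (nd M n u).
Proof.
elim/F_class_ind: u => a; rewrite F_mapE !ndE.
elim: a => [||m|a IHa b IHb|a IHa b IHb|a IHa].
- by rewrite raddf0.
- by rewrite raddf0.
- by rewrite /= tensor_map_pure /= -[1 in RHS]F_class1 F_mapE.
- by rewrite /= raddfD IHa IHb.
- by rewrite /F0_map -/F0_map !nd0M raddfD !lact_map !F_mapE IHa IHb.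
- by rewrite /= raddfMn IHa.
Qed.

End Naturality.

(* Main.v *)
Require Import Defs.
From mathcomp Require Import all_boot all_order all_algebra.

Set Implicit Arguments.
Unset Strict Implicit.

Import GRing.Theory.
Local Open Scope ring_scope.

(** The expression [f(x_m)] separates the two transformations: [n_d] sends it
    to [n] times [1 ⊗ m], so it suffices to find [M] and [m] for which the
    multiples of [1 ⊗ m] in [F M ⊗ M] are pairwise distinct.  Since the tensor
    product is a quotient, distinctness must be detected by a homomorphism out
    of it.  The constant term [F M -> nat], killing every [x_m] and every
    [f(a)], is additive and maps [1] to [1]; it therefore induces the map
    [u ⊗ m |-> constant_term u * m] to [M] ([contract]), under which
    [n_d (f(x_m))] becomes [n * m] ([contract_nd]).  With [M = nat] and [m = 1]
    the value is [n] itself. *)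

Section Contraction.
Variable M : nmodType.

Fixpoint constant_term0 (a : F0 M) : nat :=
  match a with
  | FOne => 1
  | FAdd a b => constant_term0 a + constant_term0 b
  | FMul a b => constant_term0 a * constant_term0 b
  | _ => 0
  end.

Lemma constant_term0_eqv a b :
  F_eqv a b -> constant_term0 a = constant_term0 b.
Proof.
elim=> {a b} //=.
- by move=> a b c _ -> _ ->.
- by move=> a b c; rewrite addnA.
- by move=> a; rewrite addn0.
- by move=> a b; rewrite addnC.
- by move=> a b c; rewrite mulnA.
- by move=> a; rewrite muln1.
- by move=> a b; rewrite mulnC.
- by move=> a b c; rewrite mulnDl.
- by move=> a b c _ ->.
- by move=> a b c _ ->.
Qed.

Definition constant_term (u : F M) : nat := constant_term0 (generic_quotient.repr u).

Lemma constant_termE a : constant_term (F_class a) = constant_term0 a.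
Proof. exact/constant_term0_eqv/feq_repr. Qed.

Lemma contract_bim :
  bimorphism (fun (u : F M) (m : M) => m *+ constant_term u).
Proof.
split=> [m|u|u v m|u m m'].
- by rewrite -F_class0 constant_termE.
- exact: mul0rn.
- elim/F_class_ind: u => a; elim/F_class_ind: v => b.
  by rewrite -F_classD !constant_termE mulrnDr.
- exact: mulrnDl.
Qed.

Definition contract : {additive F M ⊗ M -> M} := tensor_lift contract_bim.

Lemma contract_nd n (m : M) :
  contract (nd M n (F_class (Ffun (FVar m)))) = m *+ n.
Proof. by rewrite ndE /= raddfMn /= tensor_lift_pure -F_class1 constant_termE. Qed.

End Contraction.

Theorem proposition7p1 (n p : nat) (hnp : n <> p) :
  exists M : nmodType, nd M n <> nd M p.
Proof.
exists nat => eq_nd; apply: hnp.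
by rewrite -[n]natn -[p]natn -!contract_nd eq_nd.
Qed.
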